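(* For $n\ge 3$ let $V=V_n\in\mathbb{C}^{n\times n}$ be the eigenvector matrix defined in the context. Then $$\mathrm{Cond}_2(V_n)=\mathcal{O}(n^3),$$ that is, there is a constant $C>0$ independent of $n$ such that $\mathrm{Cond}_2(V_n)\le C n^3$ for all $n\ge 3$.
   Context: $\mathrm{i}=\sqrt{-1}$. $T_k$ and $U_k$ denote the Chebyshev polynomials of the first and second kind, of degree $k$, characterized by $T_k(\cos\theta)=\cos(k\theta)$ and $U_k(\cos\theta)=\sin((k+1)\theta)/\sin\theta$, regarded as polynomials in a complex variable. For $n\ge3$, let $\mathcal{B}=(\mathcal{B}_{jk})_{j,k=1}^n$ be the real $n\times n$ matrix whose only nonzero entries are: for $1\le j\le n-1$, $\mathcal{B}_{j,j+1}=\tfrac12$; for $2\le j\le n-1$, $\mathcal{B}_{j,j-1}=-\tfrac12$; and in the last row $\mathcal{B}_{n,n-2}=\tfrac12$, $\mathcal{B}_{n,n-1}=-2$, $\mathcal{B}_{n,n}=\tfrac32$. Its eigenvalues are $\lambda_j=\mathrm{i}x_j$, $j=1,\dots,n$, where $x_1,\dots,x_n\in\mathbb{C}$ are the $n$ distinct roots of $U_{n-1}(x)+\mathrm{i}U_{n-2}(x)-\mathrm{i}T_n(x)+T_{n-1}(x)=0$. The eigenvector matrix of $\mathcal{B}$ is $V=[P_1,\dots,P_n]$, whose $j$th column is $P_j=[p_{j,0},\dots,p_{j,n-1}]^\top$ with $p_{j,k}=\mathrm{i}^kU_k(x_j)$ for $k=0,\dots,n-1$. Equivalently $V=E\Phi$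 with $E=\mathrm{diag}(\mathrm{i}^0,\mathrm{i}^1,\dots,\mathrm{i}^{n-1})$ and $\Phi=\big(U_{k-1}(x_j)\big)_{k,j=1}^n$ ($k$ row index, $j$ column index). $\mathrm{Cond}_2(V)=\|V\|_2\|V^{-1}\|_2$ is the condition number in the spectral norm. *)

(* Defs.v *)
From HB Require Import structures.
From mathcomp Require Import all_boot all_order all_algebra.
From mathcomp Require Import complex.
From mathcomp Require Import classical_sets reals sequences exp trigo.
From mathcomp Require Import ring lra zify.

Set Implicit Arguments.
Unset Strict Implicit.
Unset Printing Implicit Defensive.

Import Order.TTheory GRing.Theory Num.Theory.
Import ComplexField.Normc.

Local Open Scope classical_set_scope.
Local Open Scope ring_scope.

Section Chebyshev.
Variable K : comNzRingType.

Fixpoint chebT (k : nat) : {poly K} :=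
  if k is k1.+1 then
    if k1 is k2.+1 then 'X *+ 2 * chebT k1 - chebT k2 else 'X
  else 1.

Fixpoint chebU (k : nat) : {poly K} :=
  if k is k1.+1 then
    if k1 is k2.+1 then 'X *+ 2 * chebU k1 - chebU k2 else 'X *+ 2
  else 1.

Lemma chebTSS k : chebT k.+2 = 'X *+ 2 * chebT k.+1 - chebT k.
Proof. by []. Qed.

Lemma chebUSS k : chebU k.+2 = 'X *+ 2 * chebU k.+1 - chebU k.
Proof. by []. Qed.

Lemma chebTSS_horner k x :
  (chebT k.+2).[x] = x *+ 2 * (chebT k.+1).[x] - (chebT k).[x].
Proof. by rewrite chebTSS hornerD hornerN hornerM hornerMn hornerX. Qed.

Lemma chebUSS_horner k x :
  (chebU k.+2).[x] = x *+ 2 * (chebU k.+1).[x] - (chebU k).[x].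
Proof. by rewrite chebUSS hornerD hornerN hornerM hornerMn hornerX. Qed.

Lemma chebT_chebU k : chebT k.+2 = 'X * chebU k.+1 - chebU k.
Proof.
suff: chebT k.+2 = 'X * chebU k.+1 - chebU k /\
      chebT k.+3 = 'X * chebU k.+2 - chebU k.+1 by case.
elim: k => [|k [IH1 IH2]]; first by rewrite /=; split; ring.
by split => //; rewrite chebTSS IH2 IH1 !chebUSS; ring.
Qed.

Lemma coef_chebU k i : (k <= i)%N -> (chebU k)`_i = (i == k)%:R * 2 ^+ k.
Proof.
suff: (forall i, (k <= i)%N -> (chebU k)`_i = (i == k)%:R * 2 ^+ k) /\
      (forall i, (k.+1 <= i)%N -> (chebU k.+1)`_i = (i == k.+1)%:R * 2 ^+ k.+1).
  by case=> + _; apply.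
elim: k {i} => [|k [IH1 IH2]].
  split=> i ki; first by rewrite coef1 mulr1.
  rewrite (_ : chebU 1 = 'X *+ 2) // coefMn coefX expr1 mulr_natr //.
split=> // i ki; rewrite chebUSS mulr2n mulrDl coefB coefD.
case: i ki => // i ki.
have -> : ('X * chebU k.+1)`_i.+1 = (i == k.+1)%:R * 2 ^+ k.+1.
  by rewrite coefXM; apply: IH2.
have -> : (chebU k)`_i.+1 = 0.
  by rewrite IH1 ?gtn_eqF ?mul0r // ltnW // ltnW.
by rewrite subr0 eqSS [2 ^+ k.+2]exprS; ring.
Qed.

End Chebyshev.

Arguments chebT : simpl never.
Arguments chebU : simpl never.

Lemma map_chebT (K L : comNzRingType) (f : {rmorphism K -> L}) k :
  map_poly f (chebT K k) = chebT L k.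
Proof.
suff: map_poly f (chebT K k) = chebT L k /\
      map_poly f (chebT K k.+1) = chebT L k.+1 by case.
elim: k => [|k [IH1 IH2]]; first by rewrite rmorph1 map_polyX.
by split=> //; rewrite !chebTSS rmorphB rmorphM rmorphMn /= map_polyX IH1 IH2.
Qed.

Lemma map_chebU (K L : comNzRingType) (f : {rmorphism K -> L}) k :
  map_poly f (chebU K k) = chebU L k.
Proof.
suff: map_poly f (chebU K k) = chebU L k /\
      map_poly f (chebU K k.+1) = chebU L k.+1 by case.
elim: k => [|k [IH1 IH2]]; first by rewrite rmorph1 /= rmorphMn /= map_polyX.
by split=> //; rewrite !chebUSS rmorphB rmorphM rmorphMn /= map_polyX IH1 IH2.
Qed.

Lemma chebT_cos (R : realType) k (t : R) : (chebT R k).[cos t] = cos (k%:R * t).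
Proof.
suff: (chebT R k).[cos t] = cos (k%:R * t) /\
      (chebT R k.+1).[cos t] = cos (k.+1%:R * t) by case.
elim: k => [|k [IH1 IH2]]; first by rewrite hornerC hornerX mul0r mul1r cos0.
split=> //; rewrite chebTSS_horner IH2 IH1.
have -> : k.+2%:R * t = k.+1%:R * t + t by rewrite -natr1 mulrDl mul1r.
have -> : k%:R * t = k.+1%:R * t - t by rewrite -natr1; ring.
by rewrite cosB cosD; ring.
Qed.

Lemma chebU_cos (R : realType) k (t : R) :
  (chebU R k).[cos t] * sin t = sin (k.+1%:R * t).
Proof.
suff: (chebU R k).[cos t] * sin t = sin (k.+1%:R * t) /\
      (chebU R k.+1).[cos t] * sin t = sin (k.+2%:R * t) by case.
elim: k => [|k [IH1 IH2]].
  rewrite hornerC !mul1r; split=> //.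
  have -> : 2%:R * t = t + t by ring.
  by rewrite sinD hornerMn hornerX; ring.
split=> //; rewrite chebUSS_horner mulrBl -mulrA IH2 IH1.
have -> : k.+3%:R * t = k.+2%:R * t + t by rewrite -natr1 mulrDl mul1r.
have -> : k.+1%:R * t = k.+2%:R * t - t by rewrite -[k.+2%:R]natr1; ring.
by rewrite sinB sinD; ring.
Qed.

Section SpectralNorm.
Variable R : realType.
Local Notation C := R[i].

Definition l2norm m (v : 'cV[C]_m) : R :=
  Num.sqrt (\sum_(i < m) normc (v i 0) ^+ 2).

Definition spectral_norm m n (A : 'M[C]_(m, n)) : R :=
  sup [set l2norm (A *m v) | v in [set v : 'cV[C]_n | l2norm v <= 1]].

Definition cond2 n (A : 'M[C]_n) : R :=
  spectral_norm A * spectral_norm (invmx A).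

Lemma normc_ge0 (z : C) : 0 <= normc z.
Proof. by case: z => a b; apply: sqrtr_ge0. Qed.

Lemma normc_sum (I : Type) (r : seq I) (F : I -> C) :
  normc (\sum_(i <- r) F i) <= \sum_(i <- r) normc (F i).
Proof.
elim/big_rec2: _ => [|i y z _ le]; first by rewrite normc0.
by rewrite (le_trans (le_normcD _ _))// lerD2l.
Qed.

Lemma has_sup_spectral_norm m n (A : 'M[C]_(m, n)) :
  has_sup [set l2norm (A *m v) | v in [set v : 'cV[C]_n | l2norm v <= 1]].
Proof.
split.
  exists (l2norm (A *m 0)), 0 => //=.
  by rewrite /l2norm big1 ?sqrtr0 // => i _; rewrite mxE normc0 expr0n.
exists (Num.sqrt (\sum_(i < m) (\sum_(j < n) normc (A i j)) ^+ 2)).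
move=> _ [v /= v1 <-].
rewrite ler_wsqrtr // ler_sum // => i _.
rewrite ler_sqr ?nnegrE ?normc_ge0 ?sumr_ge0 //; last first.
  by move=> j _; apply: normc_ge0.
rewrite mxE (le_trans (normc_sum _ _)) // ler_sum // => j _.
rewrite normcM ler_piMr ?normc_ge0 //.
apply: le_trans v1; rewrite /l2norm -[leLHS]ger0_norm ?normc_ge0 //.
rewrite -sqrtr_sqr ler_wsqrtr // (bigD1 j) //= lerDl sumr_ge0 // => k _.
exact: sqr_ge0.
Qed.

End SpectralNorm.

Section EigenvectorMatrix.
Variable R : realType.
Local Notation C := R[i].

(* Indices start at 0: entry (j, k) is the entry (j + 1, k + 1) of the
   1-based description of the matrix. *)
Definition Bmx n : 'M[C]_n := \matrix_(j < n, k < n)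
  if j.+1 == n then
    if k.+3 == n then 2^-1 else
    if k.+2 == n then - 2 else
    if k.+1 == n then 3 / 2 else 0
  else
    if k == j.+1 :> nat then 2^-1 else
    if k.+1 == j then - 2^-1 else 0.

Definition eigpoly n : {poly C} :=
  chebU C n.-1 + 'i%C%:P * chebU C n.-2 - 'i%C%:P * chebT C n + chebT C n.-1.

Definition distinct_roots n (x : 'I_n -> C) : Prop :=
  injective x /\ forall z : C, root (eigpoly n) z <-> exists j, x j = z.

Definition eigvecmx n (x : 'I_n -> C) : 'M[C]_n :=
  \matrix_(k < n, j < n) ('i%C ^+ k * (chebU C k).[x j]).

Lemma Bmx_eigvecmx n (x : 'I_n -> C) : (3 <= n)%N ->
  (forall j, root (eigpoly n) (x j)) ->
  Bmx n *m eigvecmx x = eigvecmx x *m diag_mx (\row_j ('i%C * x j)).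
Proof.
case: n x => [|[|[|m]]] // x _ rx.
have i2 : 'i%C * 'i%C = -1 :> C by rewrite -expr2 sqr_i.
apply/matrixP => j l; rewrite mul_mx_diag !mxE.
set z := x l.
pose u k := (chebU C k).[z].
have pz : u m.+2 + 'i%C * u m.+1 - 'i%C * (z * u m.+2 - u m.+1)
          + (z * u m.+1 - u m) = 0.
  have /rootP := rx l; rewrite /eigpoly /= !chebT_chebU /u -/z.
  move: (chebU C m.+2) (chebU C m.+1) (chebU C m) => p2 p1 p0.
  by rewrite !(hornerD, hornerN, hornerM, hornerC, hornerX).
have Uz : u m.+2 = z *+ 2 * u m.+1 - u m := chebUSS_horner m z.
pose v k : C := 'i%C ^+ k * u k.
have vSS k : v k.+2 = 'i%C * z *+ 2 * v k.+1 + v k.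
  rewrite /v /u chebUSS_horner !exprS.
  rewrite [LHS](_ : _ = ('i%C * 'i%C) * 'i%C ^+ k * (z *+ 2 * (chebU C k.+1).[z] - (chebU C k).[z])); last by ring.
  by rewrite i2 -[in RHS]mulrA; ring : i2.
have E (k : 'I_m.+3) : Bmx m.+3 j k * eigvecmx x k l = Bmx m.+3 j k * v k.
  by rewrite !mxE.
under eq_bigr => k _ do rewrite E.
rewrite -/(v j); case: (eqVneq j.+1 m.+3) => [jn|jn].
  rewrite !big_ord_recr big1 /= => [|k _]; last first.
    rewrite mxE jn eqxx /=.
    have := ltn_ord k; do 3 (case: eqP => [|_]; first lia).
    by rewrite mul0r.
  rewrite !mxE /= jn !eqxx !eqSS !gtn_eqF ?ltnS ?leqnSn //.
  have -> : v j = v m.+2 by move: jn => [->].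
  rewrite add0r; rewrite /v !exprS ['i%C * ('i%C * _)]mulrA i2.
  apply/eqP; rewrite -subr_eq0; apply/eqP.
  rewrite -[RHS](mulr0 (- 'i%C ^+ m)) -pz Uz.
  by field.
  
case j0: (j : nat) => [|j'].
  rewrite (bigD1 (inord 1)) //= big1 => [|k]; last first.
    rewrite -val_eqE /= inordK // => k1.
    by rewrite mxE (negPf jn) j0 (negPf k1) mul0r.
  rewrite mxE (negPf jn) j0 inordK // eqxx /v /u /=.
  have -> : (chebU C 1).[z] = z *+ 2 by rewrite hornerMn hornerX.
  have -> : (chebU C 0).[z] = 1 by rewrite hornerC.
  by field.
have j2 : (j'.+2 < m.+3)%N by have := ltn_ord j; lia.
rewrite (bigD1 (inord j'.+2)) // (bigD1 (inord j')) /=; last first.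
  by rewrite -val_eqE /= !inordK //; lia.
rewrite big1 => [|k]; last first.
  rewrite -!val_eqE /= !inordK //; last by lia.
  move=> /andP[/negPf k1 /negPf k2].
  by rewrite mxE (negPf jn) j0 k1 eqSS k2 mul0r.
rewrite !mxE (negPf jn) j0 !inordK //; last by lia.
rewrite !eqxx ltn_eqF // vSS.
by field.
Qed.

Lemma eigvecmx_unit n (x : 'I_n -> C) : injective x -> eigvecmx x \in unitmx.
Proof.
move=> xI.
pose L : 'M[C]_n := \matrix_(k, l) ('i%C ^+ k * (chebU C k)`_l).
have -> : eigvecmx x = L *m Vandermonde n (\row_j x j).
  apply/matrixP => k j; rewrite !mxE (@horner_coef_wide _ n); last first.
    apply/leq_sizeP => i ni; rewrite coef_chebU; last by have := ltn_ord k; lia.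
    by have -> : (i == k) = false by [have := ltn_ord k; lia]; rewrite mul0r.
  by rewrite mulr_sumr; apply: eq_bigr => l _; rewrite !mxE mulrA.
rewrite unitmxE det_mulmx unitrM; apply/andP; split.
  rewrite det_trig; last first.
    apply/is_trig_mxP => k l kl; rewrite mxE coef_chebU 1?ltnW //.
    by rewrite gtn_eqF // mul0r mulr0.
  rewrite unitfE; apply/prodf_neq0 => k _.
  rewrite mxE coef_chebU // eqxx mul1r mulf_neq0 // expf_neq0 ?pnatr_eq0 //.
  by rewrite eq_complex /= oner_eq0 andbF.
rewrite det_Vandermonde unitfE; apply/prodf_neq0 => i _; apply/prodf_neq0 => j.
move=> ij; rewrite !mxE subr_eq0 (inj_eq xI).
by apply: contraTneq ij => ->; rewrite ltnn.
Qed.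

End EigenvectorMatrix.

(* Main.v *)
Require Import Defs.
From mathcomp Require Import all_boot all_order all_algebra.
From mathcomp Require Import complex reals.
From mathcomp Require Import ring lra zify.

(** Put [l = i x], [p_k = i^k U_k(x)] and [n = m + 2]. Then [p_0 = 1],
    [p_1 = 2 l] and [p_(k+2) = 2 l p_(k+1) + p_k], and [x] is a root of the
    characteristic polynomial exactly when the boundary condition
    [(2 - l) p_(m+1) = (2 + l) p_m] holds. The last two entries of an
    eigenvector are therefore [(2 - l) s] and [(2 + l) s] for one number [s],
    and the Cassini identity turns into [2 l^3 s^2 = (-1)^(m+1)]
    ([amplitude_sqr]): the size of the end of an eigenvector is an explicit
    function of its eigenvalue.

    The inverse of [V]. The Christoffel-Darboux formula shows that the
    eigenvectors are orthogonal for a bilinear form which differs from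
    [sum_k (-1)^k p_k p'_k] only in the last two entries. This gives the rows of
    the inverse explicitly, and the diagonal value of the form is
    [(2n - 1 + 3 / l) / (4 (l^2 + 1))] ([pairing_diag]). As [|l| < 2] and
    [Re l > 0], its modulus is at least [n / 20]; comparing the two matrices
    entry by entry, the Frobenius norm of [V^-1] is at most [40 / n] times that
    of [V]. So the condition number is at most [40 / n] times the squared
    Frobenius norm of [V], and it remains to bound the latter by a multiple of
    [n^4].

    The columns of [V]. With the roots [q], [r] of [z^2 = 2 l z + 1], where
    [|r| <= 1 <= |q|], one has [|p_k| <= (k + 1) |q|^k] and
    [q^(m+1) = p_(m+1) - r p_m], so that [|q|^(m+1) <= 8 |s|]. If
    [|l| >= 1/2], then [|s| <= 2] and the squared norm of the column is
    [O(n^3)]. If [|l| <= 1/2], the two roots are well separated, all entries are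
    [O(|s|)], and the squared norm is [O(n |s|^2) = O(n / |l|^3)].
    The energy identity
    [2 (Re l) sum_(k <= m) |p_k|^2 = |s|^2 (4 - |l|^2)] ([closes_energy]) then
    also yields [Re l >= 1 / (50 n)], hence
    [1 / |l|^2 <= 50 n Re (1 / l)].

    Summation over the eigenvalues. All the numbers [Re (1 / l_j)] are positive,
    and their sum is read off from the two lowest coefficients of the
    characteristic polynomial: it is at most [4 n]
    ([sum_Re_inv_eigenvalue]). Hence [1 / |l_j| <= 15 n] for every [j], each
    [1 / |l_j|^3] is [O(n^2 Re (1 / l_j))], and the squared column norms
    [O(n^3 (1 + Re (1 / l_j)))] add up to [O(n^4)]. *)

Set Implicit Arguments.
Unset Strict Implicit.
Unset Printing Implicit Defensive.

Import Order.TTheory GRing.Theory Num.Theory.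
Import ComplexField.Normc.

Local Open Scope ring_scope.

Local Notation Re := complex.Re.
Local Notation Im := complex.Im.

(** * The three-term recurrence and its quadratic identities *)

Section Recurrence.
Variable K : comNzRingType.

(** The eigenvalue relation [(p_(k+1) - p_(k-1)) / 2 = l p_k] away from the last
    row: the leapfrog discretization of [p' = l p]. *)
Fixpoint leapfrog (l : K) (k : nat) : K :=
  if k is k1.+1 then
    if k1 is k2.+1 then 2 * l * leapfrog l k1 + leapfrog l k2 else 2 * l
  else 1.

Lemma leapfrog0 l : leapfrog l 0 = 1. Proof. by []. Qed.

Lemma leapfrog1 l : leapfrog l 1 = 2 * l. Proof. by []. Qed.

Lemma leapfrogSS l k :
  leapfrog l k.+2 = 2 * l * leapfrog l k.+1 + leapfrog l k.
Proof. by []. Qed.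

Arguments leapfrog : simpl never.

Lemma leapfrog_chebU (i x : K) k : i * i = -1 ->
  i ^+ k * (chebU K k).[x] = leapfrog (i * x) k.
Proof.
move=> i2; suff: i ^+ k * (chebU K k).[x] = leapfrog (i * x) k /\
    i ^+ k.+1 * (chebU K k.+1).[x] = leapfrog (i * x) k.+1 by case.
elim: k => [|k [IH1 IH2]].
  by rewrite leapfrog0 leapfrog1 !hornerC hornerMn hornerX; split; ring.
split=> //; rewrite leapfrogSS -IH1 -IH2 chebUSS_horner.
rewrite (exprD i 2 k) expr2 i2 exprS.
by rewrite mulrnAl mulr2n; ring : i2.
Qed.

Lemma leapfrog_cassini l k :
  leapfrog l k.+1 ^+ 2 - 2 * l * leapfrog l k.+1 * leapfrog l k
    - leapfrog l k ^+ 2 = (-1) ^+ k.+1.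
Proof.
elim: k => [|k IH]; first by rewrite leapfrog0 leapfrog1; ring.
by rewrite leapfrogSS [RHS]exprS -IH; ring.
Qed.

(** Since [2 l p_k = p_(k+1) - p_(k-1)], the factor [2 (l - l')] turns each term
    into a difference of consecutive signed Casoratians, so that the sum
    telescopes. *)
Lemma christoffel_darboux l l' m :
  2 * (l - l') * \sum_(k < m.+1) (-1) ^+ k * leapfrog l k * leapfrog l' k =
  (-1) ^+ m * (leapfrog l m.+1 * leapfrog l' m
               - leapfrog l m * leapfrog l' m.+1).
Proof.
elim: m => [|m IH]; first by rewrite big_ord1 !leapfrog0 !leapfrog1 /=; ring.
by rewrite big_ord_recr mulrDr IH !leapfrogSS (exprS _ m) /=; ring.
Qed.

(** The confluent case [l = l']. Dividing the Christoffel-Darboux formula by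
    [l - l'] would bring in derivatives; in terms of the roots [q], [r] of
    [z^2 = 2 l z + 1], the factor [4 (l^2 + 1) = (q - r)^2] clears the
    denominators of [p_k^2] and leaves two geometric sums and a constant. The
    induction step is the Cassini identity. *)
Lemma christoffel_darboux_diag l m :
  4 * (l ^+ 2 + 1) * \sum_(k < m.+1) (-1) ^+ k * leapfrog l k ^+ 2 =
  m.*2.+3%:R + (-1) ^+ m * (leapfrog l m.+1 ^+ 2 + leapfrog l m ^+ 2).
Proof.
elim: m => [|m IH]; first by rewrite big_ord1 double0 leapfrog0 leapfrog1; ring.
rewrite big_ord_recr mulrDr IH.
have -> : m.+1.*2.+3%:R = m.*2.+3%:R + 2 :> K by rewrite doubleS -natrD addn2.
have /eqP := leapfrog_cassini l m; rewrite -subr_eq0 => /eqP H.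
have Hs : (-1 : K) ^+ m * (-1) ^+ m = 1.
  by rewrite -exprD addnn -signr_odd odd_double.
apply/eqP; rewrite -subr_eq0; apply/eqP.
move: H; rewrite /= leapfrogSS (exprS _ m).
move: (leapfrog l m) (leapfrog l m.+1) ((-1) ^+ m) Hs => a b e Hs H.
(* The last parenthesis is the Cassini identity [H]. *)
rewrite [LHS](_ : _ =
  2 * (e * e) - 2 - 2 * e * (b ^+ 2 - 2 * l * b * a - a ^+ 2 - -1 * e));
  last by ring.
by rewrite H Hs; ring.
Qed.

End Recurrence.

Arguments leapfrog : simpl never.

(** * The boundary condition *)

Section BoundaryCondition.
Variables (F : fieldType) (m : nat).

(** The last row of the eigenvalue equation, once the recurrence has been used
    to eliminate the entry before the last two. *)
Definition closes (l : F) : Prop :=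
  (2 - l) * leapfrog l m.+1 = (2 + l) * leapfrog l m.

(** Under the boundary condition this is the common value of
    [p_m / (2 - l)] and [p_(m+1) / (2 + l)]: the denominators add up to [4]. *)
Definition amplitude (l : F) : F := (leapfrog l m.+1 + leapfrog l m) / 4.

Hypothesis F4 : (4 : F) != 0.

Lemma closes_first l : closes l ->
  leapfrog l m = (2 - l) * amplitude l /\
  leapfrog l m.+1 = (2 + l) * amplitude l.
Proof.
move=> H; split; apply: (mulIf F4); rewrite /amplitude mulrA divfK //.
  by rewrite [RHS]mulrDr H; ring.
by rewrite [RHS]mulrDr -H; ring.
Qed.

(** The Cassini identity for the last two entries [(2 - l) s] and [(2 + l) s]:
    on the left, all powers of [l] below the third cancel. *)
Lemma amplitude_sqr l : closes l ->
  2 * l ^+ 3 * amplitude l ^+ 2 = (-1) ^+ m.+1.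
Proof.
by case/closes_first=> a b; rewrite -(leapfrog_cassini l m) a b; ring.
Qed.

Lemma closes_neq0 l : closes l -> l != 0.
Proof.
move=> /amplitude_sqr H; apply/eqP => l0; move/eqP: H.
by rewrite l0 expr0n mulr0 mul0r eq_sym signr_eq0.
Qed.

Lemma closes_amplitude_neq0 l : closes l -> amplitude l != 0.
Proof.
move=> /amplitude_sqr H; apply/eqP => l0; move/eqP: H.
by rewrite l0 expr0n mulr0 eq_sym signr_eq0.
Qed.

(** The alternating form has a boundary term in the Christoffel-Darboux formula;
    under the boundary condition that term is a multiple of
    [(l - l') s s'], and the last summand is chosen to cancel it. *)
Definition pairing (l l' : F) : F :=
  \sum_(k < m.+1) (-1) ^+ k * leapfrog l k * leapfrog l' k
  + (-1) ^+ m.+1 * 2 * amplitude l * amplitude l'.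

Lemma pairing_orthogonal l l' : closes l -> closes l' -> l != l' ->
  pairing l l' = 0.
Proof.
move=> /closes_first[a b] /closes_first[a' b'] ll'.
have F2 : (2 : F) != 0.
  by apply: contraNneq F4 => F2; rewrite (natrM _ 2 2) F2 mul0r.
have c0 : 2 * (l - l') != 0 by rewrite mulf_neq0 // subr_eq0.
apply: (mulfI c0); rewrite mulr0 /pairing mulrDr christoffel_darboux.
by rewrite a b a' b' exprS; ring.
Qed.

(** On the right stands the logarithmic derivative of the characteristic
    equation, written for [q] as [(-1)^n q^(2n-1) ((1-q)/(1+q))^3 = 1] with
    [n = m + 2]; this is why it is so simple. *)
Lemma pairing_diag l : closes l ->
  4 * (l ^+ 2 + 1) * pairing l l = m.*2.+3%:R + 3 / l.
Proof.
move=> lc; have [a b] := closes_first lc; have l0 := closes_neq0 lc.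
rewrite /pairing mulrDr.
under eq_bigr do rewrite -mulrA -expr2.
rewrite christoffel_darboux_diag a b.
have s2 := amplitude_sqr lc.
have Hs : (-1 : F) ^+ m * (-1) ^+ m = 1.
  by rewrite -exprD addnn -signr_odd odd_double.
apply: (mulIf l0); rewrite [in RHS]mulrDl divfK //.
move: s2; rewrite !(exprS _ m); move: (amplitude l) ((-1) ^+ m) Hs => s e Hs s2.
rewrite [LHS](_ : _ =
  m.*2.+3%:R * l - 3 * e * (2 * l ^+ 3 * s ^+ 2)); last by ring.
by rewrite s2 !mulN1r mulrN opprK -mulrA Hs; ring.
Qed.

End BoundaryCondition.

(** * The modulus with real values *)

Section ComplexModulus.
Variable R : realType.
Implicit Types z w : R[i].

Lemma normc_sqr z : normc z ^+ 2 = Re z ^+ 2 + Im z ^+ 2.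
Proof. by case: z => a b; rewrite /= sqr_sqrtr // addr_ge0 ?sqr_ge0. Qed.

Lemma normc_nat k : normc (k%:R : R[i]) = k%:R.
Proof. by rewrite normcMn normc1. Qed.

Lemma normcX z k : normc (z ^+ k) = normc z ^+ k.
Proof. by elim: k => [|k IH]; rewrite ?normc1 // !exprS normcM IH. Qed.

Lemma normcB_le z w : normc (z - w) <= normc z + normc w.
Proof. by rewrite -(normcN w) le_normcD. Qed.

Lemma normcD_ge z w : normc z - normc w <= normc (z + w).
Proof. by rewrite lerBlDr -{1}(addrK w z) normcB_le. Qed.

Lemma normc_gt0 z : z != 0 -> 0 < normc z.
Proof.
move=> z0; rewrite lt0r normc_ge0 andbT.
by apply: contraNneq z0 => /eq0_normc->.
Qed.

Lemma normc_sign k : normc ((-1) ^+ k : R[i]) = 1.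
Proof. by rewrite normcX normcN normc1 expr1n. Qed.

Lemma normc_i : normc ('i%C : R[i]) = 1.
Proof. by rewrite /= expr0n expr1n add0r sqrtr1. Qed.

Lemma Re_le_normc z : Re z <= normc z.
Proof.
apply: le_trans (ler_norm _) _.
rewrite -ler_sqr ?nnegrE ?normr_ge0 ?normc_ge0 //.
by rewrite normc_sqr real_normK ?num_real // lerDl sqr_ge0.
Qed.

Lemma Re_inv z : Re z^-1 = Re z / normc z ^+ 2.
Proof. by rewrite normc_sqr; case: z. Qed.

Lemma Re_natDM j k z : Re (j%:R + k%:R * z) = j%:R + k%:R * Re z.
Proof.
rewrite -!(rmorph_nat (real_complex R)); case: z => a b /=; ring.
Qed.

End ComplexModulus.

(** * Location of the eigenvalues and size of the eigenvectors *)

Section RootEstimates.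
Variables (R : realType) (m : nat).
Local Notation C := R[i].
Implicit Types l : C.

Let F4 : (4 : C) != 0.
Proof. by rewrite pnatr_eq0. Qed.

Lemma leapfrog_growth l k : 2 <= normc l ->
  1 <= normc (leapfrog l k) /\
  3 * normc (leapfrog l k) <= normc (leapfrog l k.+1).
Proof.
move=> l2; elim: k => [|k [IH1 IH2]].
  by rewrite leapfrog0 leapfrog1 normcM normc1 normc_nat; split=> //; lra.
split; first lra.
rewrite leapfrogSS; have := normcD_ge (2 * l * leapfrog l k.+1) (leapfrog l k).
rewrite !normcM normc_nat.
have : 4 * normc (leapfrog l k.+1) <= 2 * normc l * normc (leapfrog l k.+1).
  by rewrite ler_wpM2r ?normc_ge0 //; lra.
lra.
Qed.

Lemma normc_amplitude_sqr l : closes m l ->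
  2 * normc l ^+ 3 * normc (amplitude m l) ^+ 2 = 1.
Proof.
move=> /(amplitude_sqr F4)/(congr1 (@normc R)).
by rewrite normc_sign 2!normcM !normcX normc_nat.
Qed.

(** For [|l| >= 2] the sequence grows by a factor of at least [3] at each step,
    so [p_(m+1)] and [p_m] cannot add up to a number as small as [4 s], where
    [2 |l|^3 |s|^2 = 1]. *)
Lemma closes_normc_lt2 l : closes m l -> normc l < 2.
Proof.
move=> lc; rewrite ltNge; apply/negP => l2.
have [p1 p3] := leapfrog_growth m l2.
have := normc_amplitude_sqr lc.
have s2 : 2^-1 <= normc (amplitude m l).
  rewrite /amplitude normcM normcV normc_nat.
  by have := normcD_ge (leapfrog l m.+1) (leapfrog l m); lra.
have l8 : 8 <= normc l ^+ 3 by have := lerXn2r 3 _ _ l2; rewrite !nnegrE; nra.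
have s4 : 4^-1 <= normc (amplitude m l) ^+ 2 by nra.
nra.
Qed.

(** By the recurrence, the real part of the Hermitian product of [p_k] and
    [p_(k+1)] exceeds the preceding one by [2 (Re l) |p_k|^2]. *)
Lemma leapfrog_energy l k :
  2 * Re l * \sum_(i < k.+1) normc (leapfrog l i) ^+ 2 =
  Re (leapfrog l k) * Re (leapfrog l k.+1)
    + Im (leapfrog l k) * Im (leapfrog l k.+1).
Proof.
elim: k => [|k IH].
  rewrite big_ord1 leapfrog0 leapfrog1 normc1; case: l => a b /=.
  by ring.
rewrite big_ord_recr mulrDr IH /= leapfrogSS normc_sqr.
by case: l (leapfrog l k) (leapfrog l k.+1) {IH} => [a b] [c d] [e f] /=; ring.
Qed.

Lemma closes_energy l : closes m l ->
  2 * Re l * \sum_(i < m.+1) normc (leapfrog l i) ^+ 2 =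
  normc (amplitude m l) ^+ 2 * (4 - normc l ^+ 2).
Proof.
move=> lc; rewrite leapfrog_energy; have [-> ->] := closes_first F4 lc.
rewrite !normc_sqr; case: l {lc} (amplitude m l) => [a b] [c d] /=; ring.
Qed.

(** In the energy identity the right-hand side is positive, as
    [|l| < 2]. *)
Lemma closes_Re_gt0 l : closes m l -> 0 < Re l.
Proof.
move=> lc; have := closes_energy lc.
have s0 := normc_gt0 (closes_amplitude_neq0 F4 lc).
have l2 := closes_normc_lt2 lc; have l0 := normc_ge0 l.
have S0 : 0 <= \sum_(i < m.+1) normc (leapfrog l i) ^+ 2.
  by apply: sumr_ge0 => i _; rewrite sqr_ge0.
have : 0 < normc (amplitude m l) ^+ 2 * (4 - normc l ^+ 2).
  by rewrite mulr_gt0 ?exprn_gt0 // subr_gt0; nra.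
move=> + H; rewrite -H => P; rewrite ltNge; apply/negP => r0; nra.
Qed.

Lemma leapfrog_char_roots l :
  exists q r : C, [/\ q + r = 2 * l, q * r = -1, normc r <= 1 & 1 <= normc q].
Proof.
pose d := sqrtc (l ^+ 2 + 1).
have d2 : d ^+ 2 = l ^+ 2 + 1 by apply: sqr_sqrtc.
(* Changing the sign of the square root exchanges the two roots. *)
wlog: d d2 / normc (l - d) <= normc (l + d).
  move=> H; case: (leP (normc (l - d)) (normc (l + d))) => [|/ltW] h.
    exact: H d d2 h.
  by apply: (H (- d)); rewrite ?sqrrN ?opprK.
have pr : (l + d) * (l - d) = -1.
  by rewrite mulrC -subr_sqr d2; ring.
have : normc (l + d) * normc (l - d) = 1 by rewrite -normcM pr normcN normc1.
have := normc_ge0 (l + d); have := normc_ge0 (l - d).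
move=> h1 h2 h3 h4; exists (l + d), (l - d); split=> //; first by ring.
  by nra.
by nra.
Qed.

Section CharRoots.
Variables (l q r : C).
Hypotheses (qDr : q + r = 2 * l) (qMr : q * r = -1).
Hypotheses (r1 : normc r <= 1) (q1 : 1 <= normc q).

(** One root of the characteristic equation of the recurrence is split off. *)
Lemma leapfrog_step k : leapfrog l k.+1 = r * leapfrog l k + q ^+ k.+1.
Proof using qDr qMr.
elim: k => [|k IH].
  by rewrite leapfrog0 leapfrog1 -qDr; ring.
rewrite exprS -[q ^+ k.+1](addKr (r * leapfrog l k)) -IH leapfrogSS -qDr.
by rewrite mulrDr mulrN mulrA qMr; ring.
Qed.

Lemma normc_leapfrog k : normc (leapfrog l k) <= k.+1%:R * normc q ^+ k.
Proof using qDr qMr r1 q1.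
elim: k => [|k IH]; first by rewrite leapfrog0 normc1 mul1r.
rewrite leapfrog_step -natr1 mulrDl mul1r.
apply: le_trans (le_normcD _ _) _; rewrite normcM normcX lerD2r.
apply: le_trans (_ : normc (leapfrog l k) <= _).
  by rewrite ler_piMl ?normc_ge0.
apply: le_trans IH _; rewrite ler_wpM2l // exprS ler_peMl //.
by rewrite exprn_ge0 ?normc_ge0.
Qed.

Lemma leapfrog_binet k : (q - r) * leapfrog l k = q ^+ k.+1 - r ^+ k.+1.
Proof using qDr qMr.
elim: k => [|k IH]; first by rewrite leapfrog0; ring.
rewrite leapfrog_step mulrDr mulrCA IH !exprS; ring.
Qed.

(** The dominant root is controlled by the last two entries, because
    [q^(m+1) = p_(m+1) - r p_m] and [|r| <= 1]. *)
Lemma normc_char_root : closes m l ->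
  normc q ^+ m.+1 <= 8 * normc (amplitude m l).
Proof using qDr qMr r1.
move=> lc; have [a b] := closes_first F4 lc.
have -> : normc q ^+ m.+1 = normc (leapfrog l m.+1 - r * leapfrog l m).
  by rewrite leapfrog_step addrC addKr normcX.
apply: le_trans (normcB_le _ _) _; rewrite a b.
move: (amplitude m l) {a b} => s; rewrite !normcM.
have l2 := closes_normc_lt2 lc.
have := le_normcD 2 l; have := normcB_le 2 l; rewrite normc_nat.
have := normc_ge0 (2 - l); have := normc_ge0 r.
move: (normc_ge0 s); move: (normc (2 - l)) (normc (2 + l)).
move: (normc s) => {}s x y s0 r0 x0 hx hy.
have rx : normc r * (x * s) <= 4 * s.
  apply: le_trans (_ : x * s <= _); first by rewrite ler_piMl ?mulr_ge0.
  by rewrite ler_wpM2r //; lra.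
have : y * s <= 4 * s by rewrite ler_wpM2r //; lra.
lra.
Qed.

End CharRoots.

Lemma normc_leapfrog_closes l k : closes m l -> (k <= m.+1)%N ->
  normc (leapfrog l k) <= m.+2%:R * (8 * normc (amplitude m l)).
Proof.
move=> lc km; have [q [r [qDr qMr r1 q1]]] := leapfrog_char_roots l.
apply: le_trans (normc_leapfrog qDr qMr r1 q1 k) _.
apply: ler_pM; rewrite ?exprn_ge0 ?normc_ge0 // ?ler_nat //.
by apply: le_trans (normc_char_root qDr qMr r1 lc); rewrite ler_weXn2l.
Qed.

(** For [|l| <= 1/2] the roots are separated, [|q - r|^2 = 4 |l^2 + 1| >= 3], so
    Binet's formula bounds every entry, without a factor [k], by a multiple of
    the amplitude; [86] is the integer above [16^2 / 3]. *)
Lemma normc_leapfrog_small l k : closes m l -> normc l <= 2^-1 ->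
  (k <= m)%N ->
  normc (leapfrog l k) ^+ 2 <= 86 * normc (amplitude m l) ^+ 2.
Proof.
move=> lc l2 km; have [q [r [qDr qMr r1 q1]]] := leapfrog_char_roots l.
have qr3 : 3 <= normc (q - r) ^+ 2.
  rewrite -normcX (_ : _ ^+ 2 = 4 * (1 + l ^+ 2)); last first.
    rewrite [LHS](_ : _ = (q + r) ^+ 2 - 4 * (q * r)); last by ring.
    by rewrite qDr qMr; ring.
  rewrite normcM normc_nat.
  have := normcD_ge 1 (l ^+ 2); rewrite normc1 normcX.
  by have := normc_ge0 l; nra.
have h : normc (q - r) * normc (leapfrog l k) <= 16 * normc (amplitude m l).
  rewrite -normcM (leapfrog_binet qDr qMr).
  apply: le_trans (normcB_le _ _) _; rewrite !normcX.
  have := normc_char_root qDr qMr r1 lc.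
  have : normc q ^+ k.+1 <= normc q ^+ m.+1 by rewrite ler_weXn2l.
  have : normc r ^+ k.+1 <= 1 by rewrite exprn_ile1 ?normc_ge0.
  have : 1 <= normc q ^+ k.+1 by rewrite exprn_ege1.
  lra.
have : (normc (q - r) * normc (leapfrog l k)) ^+ 2
    <= (16 * normc (amplitude m l)) ^+ 2.
  by rewrite lerXn2r ?nnegrE ?mulr_ge0 ?normc_ge0.
rewrite !exprMn; have := sqr_ge0 (normc (leapfrog l k)).
have := sqr_ge0 (normc (amplitude m l)).
by nra.
Qed.

Definition colnorm2 l : R := \sum_(k < m.+2) normc (leapfrog l k) ^+ 2.

Lemma colnorm2_large l : closes m l -> 2^-1 <= normc l ->
  colnorm2 l <= 256 * m.+2%:R ^+ 3.
Proof.
move=> lc l2.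
have s4 : normc (amplitude m l) ^+ 2 <= 4.
  have := normc_amplitude_sqr lc.
  have : 8^-1 <= normc l ^+ 3.
    have -> : 8^-1 = 2^-1 ^+ 3 :> R by field.
    by rewrite lerXn2r ?nnegrE ?normc_ge0 ?invr_ge0.
  have := sqr_ge0 (normc (amplitude m l)).
  by nra.
apply: le_trans (_ : \sum_(k < m.+2) 256 * m.+2%:R ^+ 2 <= _).
  apply: ler_sum => k _.
  have := normc_leapfrog_closes lc (ltn_ord k : (k <= m.+1)%N).
  rewrite -(ler_sqr (normc_ge0 _)) ?nnegrE ?mulr_ge0 ?normc_ge0 //.
  move=> /le_trans; apply; rewrite !exprMn.
  rewrite [leLHS](_ : _ = 64 * m.+2%:R ^+ 2 * normc (amplitude m l) ^+ 2).
    apply: le_trans (_ : 64 * m.+2%:R ^+ 2 * 4 <= _).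
      by rewrite ler_wpM2l // mulr_ge0 ?sqr_ge0.
    by rewrite le_eqVlt; apply/orP; left; apply/eqP; ring.
  by ring.
rewrite sumr_const card_ord -[leLHS]mulr_natl le_eqVlt.
by apply/orP; left; apply/eqP; ring.
Qed.

Lemma sum_leapfrog_small l : closes m l -> normc l <= 2^-1 ->
  \sum_(k < m.+1) normc (leapfrog l k) ^+ 2
    <= 86 * m.+1%:R * normc (amplitude m l) ^+ 2.
Proof.
move=> lc l2.
apply: le_trans (_ : \sum_(k < m.+1) 86 * normc (amplitude m l) ^+ 2 <= _).
  apply: ler_sum => k _; apply: normc_leapfrog_small => //.
  exact: (ltn_ord k).
rewrite sumr_const card_ord -[leLHS]mulr_natl le_eqVlt.
by apply/orP; left; apply/eqP; ring.
Qed.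

(** The energy identity, read backwards: an upper bound on the entries is a
    lower bound on [Re l]. *)
Lemma Re_small l : closes m l -> normc l <= 2^-1 -> 1 <= 50 * m.+2%:R * Re l.
Proof.
move=> lc l2; have := closes_energy lc; have := sum_leapfrog_small lc l2.
have s0 := normc_gt0 (closes_amplitude_neq0 F4 lc).
have re0 := closes_Re_gt0 lc; have l0 := normc_ge0 l.
have -> : m.+2%:R = m.+1%:R + 1 :> R by rewrite natr1.
have M0 : 0 <= m.+1%:R :> R by [].
have : 0 < normc (amplitude m l) ^+ 2 by rewrite exprn_gt0.
move: (normc (amplitude m l) ^+ 2) (\sum_(k < m.+1) _) (m.+1%:R) M0.
move=> s S M M0 {}s0 hS hE.
have h4 : 15 / 4 * s <= s * (4 - normc l ^+ 2).
  by rewrite mulrC ler_wpM2l ?(ltW s0) //; nra.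
have : 2 * Re l * S <= 2 * Re l * (86 * M * s).
  by rewrite ler_wpM2l // mulr_ge0 ?ltW.
rewrite hE => h5; have h6 : 15 / 4 * s <= 172 * M * Re l * s by lra.
have := h6; rewrite ler_pM2r // => h7.
have : 0 <= M * Re l by rewrite mulr_ge0 // ltW.
by lra.
Qed.

Lemma colnorm2_small l : closes m l -> normc l <= 2^-1 ->
  colnorm2 l <= 86 * m.+2%:R * normc (amplitude m l) ^+ 2.
Proof.
move=> lc l2; rewrite /colnorm2 big_ord_recr /=.
rewrite -(natr1 m.+1) mulrDr mulr1 [leRHS]mulrDl lerD ?sum_leapfrog_small //.
have [_ ->] := closes_first F4 lc.
rewrite normcM exprMn ler_wpM2r ?sqr_ge0 //.
have := normc_ge0 (2 + l); have := le_normcD 2 l; rewrite normc_nat.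
move: (normc (2 + l)) (normc l) l2 => a b; nra.
Qed.

(** Both regimes in one bound that can be summed over the eigenvalues. The
    hypothesis holds for each eigenvalue because it holds for the sum of all
    [Re (1 / l_j)]. For small [l] it gives [1 / |l|^2 <= 50 n Re (1 / l)] and
    [1 / |l| <= 15 n], which together bound [|s|^2 = 1 / (2 |l|^3)];
    the constant [375] is [15 * 50 / 2]. *)
Lemma colnorm2_le l : closes m l -> Re l^-1 <= 4 * m.+2%:R ->
  colnorm2 l <= m.+2%:R ^+ 3 * (256 + 86 * 375 * Re l^-1).
Proof.
move=> lc hT; have N0 : 0 <= m.+2%:R :> R by [].
have re0 : 0 <= Re l^-1.
  by rewrite Re_inv divr_ge0 ?sqr_ge0 // ltW // closes_Re_gt0.
rewrite mulrDr; case: (leP 2^-1 (normc l)) => [l2|/ltW l2].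
  apply: le_trans (colnorm2_large lc l2) _; rewrite [leLHS]mulrC lerDl.
  by rewrite !mulr_ge0 ?exprn_ge0.
apply: le_trans (colnorm2_small lc l2) _.
apply: le_trans (_ : m.+2%:R ^+ 3 * (86 * 375 * Re l^-1) <= _); last first.
  by rewrite lerDr mulr_ge0 ?exprn_ge0.
have l0 := normc_gt0 (closes_neq0 F4 lc).
have l3 := normc_amplitude_sqr lc; have Rl := Re_small lc l2.
move: hT re0 l3; rewrite Re_inv.
move: (normc (amplitude m l) ^+ 2) (normc l) (Re l) (m.+2%:R) l0 N0 Rl.
move=> s L x N L0 N0 Rl; set T := x / L ^+ 2 => hT re0 l3.
pose y := L^-1; have y0 : 0 < y by rewrite invr_gt0.
have Ln : L != 0 by rewrite gt_eqF.
have yT : y ^+ 2 <= 50 * N * T.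
  by rewrite /T mulrA exprVn ler_peMl // invr_ge0 sqr_ge0.
have y15 : y <= 15 * N.
  rewrite -ler_sqr ?nnegrE ?mulr_ge0 ?(ltW y0) //; apply: le_trans yT _.
  by rewrite exprMn; nra.
have sE : s = 2^-1 * (y * y ^+ 2).
  rewrite [LHS](_ : _ = 2^-1 * (y * y ^+ 2) * (2 * L ^+ 3 * s)).
    by rewrite l3 mulr1.
  by rewrite /y; field.
have : y * y ^+ 2 <= 15 * N * (50 * N * T).
  by rewrite ler_pM ?sqr_ge0 // ltW.
move=> h; rewrite sE [leRHS](_ : _ = 86 * N * (2^-1 * (15 * N * (50 * N * T)))).
  by rewrite !ler_wpM2l ?mulr_ge0 ?invr_ge0.
by field.
Qed.

End RootEstimates.

(** * The sum of the inverse eigenvalues *)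

Section PolynomialRoots.
Variable F : fieldType.

Lemma coef1_prod_XsubC (s : seq F) : all (predC1 0) s ->
  (\prod_(z <- s) ('X - z%:P))`_1 =
  - (\prod_(z <- s) ('X - z%:P))`_0 * \sum_(z <- s) z^-1.
Proof.
elim: s => [|z s IH] /=; first by rewrite !big_nil coef1 mulr0.
case/andP=> z0 /IH; rewrite !big_cons; move: (\prod_(_ <- s) _) => p e.
rewrite !mulrBl !coefB !coefXM !coefCM e /=.
by field.
Qed.

(** The size bound and the [n] distinct roots force a complete factorization of
    [p]; Vieta's formula for the two lowest coefficients does the rest. *)
Lemma sum_inv_roots n (p : {poly F}) (x : 'I_n -> F) :
  (size p <= n.+1)%N -> p`_0 != 0 -> injective x ->
  (forall j, root p (x j)) -> \sum_(j < n) (x j)^-1 = - p`_1 / p`_0.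
Proof.
move=> szp p0 xI xr; pose s := [seq x j | j <- enum 'I_n].
have szs : size s = n by rewrite size_map size_enum_ord.
have rs : all (root p) s by apply/allP => _ /mapP[j _ ->].
have us : uniq_roots s by rewrite uniq_rootsE map_inj_uniq ?enum_uniq.
have pn0 : p != 0 by apply: contraNneq p0 => ->; rewrite coef0.
have szp' : size p = (size s).+1.
  apply/eqP; rewrite eqn_leq szs szp -{1}szs max_poly_roots //.
  by rewrite -uniq_rootsE.
have s0 : all (predC1 0) s.
  apply/allP => z /(allP rs); apply: contraTneq => ->.
  by rewrite rootE horner_coef0.
have pE := all_roots_prod_XsubC szp' rs us.
have -> : \sum_(j < n) (x j)^-1 = \sum_(z <- s) z^-1.
  by rewrite big_map big_enum.
move: p0; rewrite pE !coefZ coef1_prod_XsubC //.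
move: (lead_coef p) (_`_0) => c d; rewrite mulf_eq0 negb_or => /andP[c0 d0].
by field; rewrite d0 c0.
Qed.

End PolynomialRoots.

Section CharacteristicPolynomial.
Variable R : realType.
Local Notation C := R[i].

Let i2 : 'i%C * 'i%C = -1 :> C.
Proof. by rewrite -expr2 sqr_i. Qed.

Lemma chebT_chebU_succ (K : comNzRingType) k :
  chebT K k.+1 = chebU K k.+1 - 'X * chebU K k.
Proof.
case: k => [|k]; last by rewrite chebT_chebU chebUSS; ring.
by rewrite /chebT /chebU /=; ring.
Qed.

Lemma eigpolyE m : eigpoly R m.+2 =
  (2%:P - 'i%C%:P * 'X) * chebU C m.+1 + (2%:P * 'i%C%:P - 'X) * chebU C m.
Proof.
by rewrite polyC_natr /eigpoly /= chebT_chebU chebT_chebU_succ; ring.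
Qed.

(** Multiplying [eigpolyE] by [i^(m+1)] turns the Chebyshev values into the
    entries of the leapfrog sequence. *)
Lemma root_eigpoly_closes m (x : C) :
  root (eigpoly R m.+2) x -> closes m ('i%C * x).
Proof.
move/rootP/(congr1 ( *%R ('i%C ^+ m.+1))); rewrite mulr0 eigpolyE.
rewrite !(hornerD, hornerN, hornerM, hornerC, hornerX).
rewrite /closes -!leapfrog_chebU // => H.
apply/eqP; rewrite -subr_eq0 -H exprS; apply/eqP.
move: ('i%C : C) i2 (_.[x]) (_.[x]) => i i2' u v.
ring : i2'.
Qed.

(** Since [U_(k+2)(0) = - U_k(0)], this combination is multiplied by [i] when
    [k] increases. Twice it is the constant coefficient of the characteristic
    polynomial. *)
Lemma chebU_coef0_step k :
  normc ((chebU C k.+1)`_0 + 'i%C * (chebU C k)`_0) = 1.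
Proof.
elim: k => [|k IH].
  by rewrite /chebU coefMn coefX mul0rn coef1 add0r mulr1 normc_i.
rewrite -[RHS]IH chebUSS mulrnAl coefB coefMn coefXM mul0rn sub0r.
rewrite (_ : _ + _ = 'i%C * ((chebU C k.+1)`_0 + 'i%C * (chebU C k)`_0)).
  by rewrite normcM normc_i mul1r.
by rewrite [RHS]mulrDr mulrA i2; ring.
Qed.

Lemma chebU_coef01 k :
  normc (chebU C k)`_0 <= 1 /\ normc (chebU C k)`_1 <= 2 * k%:R.
Proof.
suff : (normc (chebU C k)`_0 <= 1 /\ normc (chebU C k)`_1 <= 2 * k%:R) /\
  (normc (chebU C k.+1)`_0 <= 1 /\ normc (chebU C k.+1)`_1 <= 2 * k.+1%:R).
  by case.
elim: k => [|k [[a b] [c d]]].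
  rewrite /chebU !coefMn !coefX !coef1 ![nat_of_bool _]/(nat_of_bool _).
  rewrite mulr0n mulr1n mul0rn.
  rewrite normcMn normc0 normc1 mulr0 mulr1 mulr2n; do 2!split=> //; lra.
have E i : (chebU C k.+2)`_i = ('X * chebU C k.+1)`_i *+ 2 - (chebU C k)`_i.
  by rewrite chebUSS mulrnAl coefB coefMn.
split=> //; rewrite !E !coefXM /= mul0rn sub0r normcN; split=> //.
apply: le_trans (normcB_le _ _) _; rewrite normcMn mulr2n.
by move: d; rewrite -(natr1 k.+1) -(natr1 k); lra.
Qed.

Lemma eigpoly_coef0 m : normc (eigpoly R m.+2)`_0 = 2.
Proof.
rewrite -[RHS]mulr1 -[X in 2 * X](chebU_coef0_step m).
rewrite -[X in X * _](normc_nat R 2) -normcM; congr normc.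
rewrite eigpolyE !mulrBl coefD !coefB -!mulrA !coefCM !coefXM.
by ring.
Qed.

Lemma eigpoly_coef1 m : normc (eigpoly R m.+2)`_1 <= 8 * m.+2%:R.
Proof.
have [a b] := chebU_coef01 m; have [c d] := chebU_coef01 m.+1.
rewrite eigpolyE !mulrBl coefD !coefB -!mulrA !coefCM !coefXM.
rewrite /=.
apply: le_trans (le_normcD _ _) _.
apply: le_trans (lerD (normcB_le _ _) (normcB_le _ _)) _.
rewrite !normcM normc_i normc_nat.
rewrite -(natr1 m.+1) -(natr1 m) in d *; lra.
Qed.

Lemma size_eigpoly m : (size (eigpoly R m.+2) <= m.+3)%N.
Proof.
have szU k j : (k < j)%N -> (chebU C k)`_j = 0.
  by move=> kj; rewrite coef_chebU ?(ltnW kj) // gtn_eqF // mul0r.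
apply/leq_sizeP => j mj; rewrite eigpolyE !mulrBl coefD !coefB -!mulrA.
rewrite !coefCM !coefXM.
case: j mj => // j mj /=.
by rewrite !szU ?mulr0 ?subr0 ?addr0 //; lia.
Qed.

Lemma sum_Re_inv_eigenvalue m (x : 'I_m.+2 -> C) : injective x ->
  (forall j, root (eigpoly R m.+2) (x j)) ->
  \sum_j Re ('i%C * x j)^-1 <= 4 * m.+2%:R.
Proof.
have ReD : {morph (@Re R) : z w / z + w} by move=> [a b] [c d].
move=> xI xr; rewrite -(big_morph _ ReD (erefl : Re (0 : C) = 0)).
apply: le_trans (Re_le_normc _) _.
under eq_bigr do rewrite invfM.
have c0 := eigpoly_coef0 m.
rewrite -mulr_sumr (sum_inv_roots (size_eigpoly m)) //; last first.
  by apply: contra_eq_neq c0 => ->; rewrite normc0 eq_sym pnatr_eq0.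
rewrite !normcM !normcV normcN c0 normc_i; have := eigpoly_coef1 m; lra.
Qed.

End CharacteristicPolynomial.

(** * The spectral norm and the Frobenius norm *)

(** Lagrange's identity: twice the gap is the double sum of the squares
    [(a_i b_j - a_j b_i)^2]. *)
Lemma cauchy_schwarz_sum (R : realType) n (a b : 'I_n -> R) :
  (\sum_i a i * b i) ^+ 2 <= (\sum_i a i ^+ 2) * (\sum_i b i ^+ 2).
Proof.
have : 0 <= \sum_i \sum_j (a i * b j - a j * b i) ^+ 2.
  by apply: sumr_ge0 => i _; apply: sumr_ge0 => j _; rewrite sqr_ge0.
have -> : \sum_i \sum_j (a i * b j - a j * b i) ^+ 2 =
    (\sum_i a i ^+ 2) * (\sum_i b i ^+ 2) *+ 2 - (\sum_i a i * b i) ^+ 2 *+ 2.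
  rewrite mulr2n {2}[_ * \sum_i b i ^+ 2]mulrC expr2 !mulr_suml -sumrMnl.
  rewrite -big_split -sumrB; apply: eq_bigr => i _ /=.
  rewrite !mulr_sumr -sumrMnl -big_split -sumrB; apply: eq_bigr => j _ /=.
  by ring.
lra.
Qed.

Section SpectralFrobenius.
Variable R : realType.
Local Notation C := R[i].

Definition frobenius2 m n (A : 'M[C]_(m, n)) : R :=
  \sum_i \sum_j normc (A i j) ^+ 2.

Lemma frobenius2_ge0 m n (A : 'M[C]_(m, n)) : 0 <= frobenius2 A.
Proof. by apply: sumr_ge0 => i _; apply: sumr_ge0 => j _; rewrite sqr_ge0. Qed.

Lemma l2norm_mulmx m n (A : 'M[C]_(m, n)) (v : 'cV[C]_n) :
  l2norm (A *m v) <= Num.sqrt (frobenius2 A) * l2norm v.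
Proof.
rewrite /l2norm -sqrtrM ?frobenius2_ge0 // ler_wsqrtr // /frobenius2.
rewrite mulr_suml; apply: ler_sum => i _; rewrite mxE.
apply: le_trans (cauchy_schwarz_sum
  (fun j => normc (A i j)) (fun j => normc (v j 0))).
rewrite lerXn2r ?nnegrE ?normc_ge0 ?sumr_ge0 // => [j _|].
  by rewrite mulr_ge0 ?normc_ge0.
by apply: le_trans (normc_sum _ _) _; apply: ler_sum => j _; rewrite normcM.
Qed.

Lemma spectral_norm_le_frobenius m n (A : 'M[C]_(m, n)) :
  spectral_norm A <= Num.sqrt (frobenius2 A).
Proof.
apply: ge_sup; first by case: (has_sup_spectral_norm A).
move=> _ [v /= v1 <-]; apply: le_trans (l2norm_mulmx A v) _.
by rewrite ler_piMr ?sqrtr_ge0.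
Qed.

Lemma spectral_norm_ge0 m n (A : 'M[C]_(m, n)) : 0 <= spectral_norm A.
Proof.
case: (has_sup_spectral_norm A) => _ ub; apply: (ub_le_sup ub).
exists 0 => /=.
  by rewrite /l2norm big1 ?sqrtr0 // => i _; rewrite mxE normc0 expr0n.
by rewrite mulmx0 /l2norm big1 ?sqrtr0 // => i _; rewrite mxE normc0 expr0n.
Qed.

Lemma cond2_le_frobenius n (A : 'M[C]_n) :
  cond2 A <= Num.sqrt (frobenius2 A * frobenius2 (invmx A)).
Proof.
rewrite sqrtrM ?frobenius2_ge0 // ler_pM ?spectral_norm_ge0 //.
  exact: spectral_norm_le_frobenius.
exact: spectral_norm_le_frobenius.
Qed.

End SpectralFrobenius.

(** * The inverse of the eigenvector matrix *)

Section LeftEigenvectors.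
Variables (R : realType) (m : nat) (x : 'I_m.+2 -> R[i]).
Local Notation C := R[i].
Hypothesis (x_inj : injective x).
Hypothesis (x_root : forall j, root (eigpoly R m.+2) (x j)).

Let F4 : (4 : C) != 0.
Proof. by rewrite pnatr_eq0. Qed.

Let l j : C := 'i%C * x j.

Let lc j : closes m (l j).
Proof. exact: root_eigpoly_closes. Qed.

Let l_inj j j' : j != j' -> l j != l j'.
Proof.
apply: contra_neq => /(mulfI _); rewrite /= => H; apply: x_inj; apply: H.
by apply: contra_eq_neq (normc_i R) => ->; rewrite normc0 eq_sym oner_eq0.
Qed.

Lemma eigvecmxE k j : eigvecmx x k j = leapfrog (l j) k.
Proof. by rewrite mxE leapfrog_chebU // -expr2 sqr_i. Qed.

(** The coefficients of the linear form [pairing lam]: the correction term of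
    the pairing contains [amplitude lam'], which is spread over the last two
    entries [k = m] and [k = m.+1]. *)
Definition left_eigenvector (lam : C) (k : nat) : C :=
  (if (k <= m)%N then (-1) ^+ k * leapfrog lam k else 0)
  + (if (m <= k)%N then (-1) ^+ m.+1 * (amplitude m lam / 2) else 0).

Lemma sum_left_eigenvector_leapfrog lam lam' :
  \sum_(k < m.+2) left_eigenvector lam k * leapfrog lam' k = pairing m lam lam'.
Proof.
rewrite /left_eigenvector /pairing.
under eq_bigr do rewrite mulrDl.
rewrite big_split /=; congr (_ + _).
  rewrite big_ord_recr /= ltnn mul0r addr0; apply: eq_bigr => k _ /=.
  by rewrite -ltnS ltn_ord.
rewrite !big_ord_recr big1 /=; last first.
  by move=> k _; rewrite leqNgt ltn_ord mul0r.
by rewrite leqnn leqnSn /amplitude; field.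
Qed.

(** [|4 (l^2 + 1)| <= 20] since [|l| < 2], and [3 / l] has positive real part,
    so that it cannot cancel the integer [2 m + 3]. *)
Lemma normc_pairing_ge j :
  m.+2%:R <= 20 * normc (pairing m (l j) (l j)).
Proof.
have lj := lc j; have l2 := closes_normc_lt2 lj; have l0 := normc_ge0 (l j).
apply: le_trans (_ : normc (m.*2.+3%:R + 3 / l j) <= _).
  apply: le_trans (Re_le_normc _); rewrite Re_natDM Re_inv.
  apply: le_trans (_ : m.*2.+3%:R <= _); first by rewrite ler_nat -addnn; lia.
  by rewrite lerDl mulr_ge0 // divr_ge0 ?sqr_ge0 // ltW // (closes_Re_gt0 lj).
rewrite -(pairing_diag F4 lj); move: (pairing m _ _) => p.
rewrite !normcM normc_nat ler_wpM2r ?normc_ge0 //.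
have := le_normcD (l j ^+ 2) 1; rewrite normcX normc1; nra.
Qed.

Lemma pairing_neq0 j : pairing m (l j) (l j) != 0.
Proof.
apply/eqP => p0; have := normc_pairing_ge j.
by rewrite p0 normc0 mulr0 lern0.
Qed.

Lemma normc_pairing_inv j : normc (pairing m (l j) (l j))^-1 <= 20 / m.+2%:R.
Proof.
have p0 := normc_gt0 (pairing_neq0 j); have H := normc_pairing_ge j.
have N0 : 0 < m.+2%:R :> R by [].
by rewrite normcV ler_pdivlMr // mulrC ler_pdivrMr.
Qed.

(** The correction in the last two entries is at most
    [(|p_m| + |p_(m+1)|) / 8], so a left eigenvector is comparable with the
    right one. *)
Lemma left_eigenvector_norm2 lam :
  \sum_(k < m.+2) normc (left_eigenvector lam k) ^+ 2 <= 4 * colnorm2 m lam.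
Proof.
rewrite /colnorm2 !big_ord_recr /= /left_eigenvector leqnn leqnSn ltnn add0r.
rewrite -!addrA !mulrDr lerD //.
  apply: le_trans (_ : \sum_(i < m) normc (leapfrog lam i) ^+ 2 <= _).
    apply: ler_sum => k _ /=; rewrite (ltnW (ltn_ord k)) leqNgt ltn_ord addr0.
    by rewrite normcM normc_sign mul1r.
  by rewrite ler_peMl ?ler1n // sumr_ge0 // => k _; rewrite sqr_ge0.
have h : normc ((-1) ^+ m.+1 * (amplitude m lam / 2)) <=
    (normc (leapfrog lam m.+1) + normc (leapfrog lam m)) / 8.
  rewrite normcM normc_sign mul1r /amplitude -mulrA normcM -invfM -natrM.
  by rewrite normcV normc_nat ler_wpM2r ?invr_ge0 // le_normcD.
have h' := le_normcD ((-1) ^+ m * leapfrog lam m)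
  ((-1) ^+ m.+1 * (amplitude m lam / 2)).
move: h h'; rewrite [normc ((-1) ^+ m * _)]normcM normc_sign mul1r.
have := normc_ge0 (leapfrog lam m); have := normc_ge0 (leapfrog lam m.+1).
have := normc_ge0 ((-1) ^+ m.+1 * (amplitude m lam / 2)).
have := normc_ge0 ((-1) ^+ m * leapfrog lam m
  + (-1) ^+ m.+1 * (amplitude m lam / 2)).
move: (normc (_ + _)) (normc (_ * (_ / _))) (normc (leapfrog lam m)).
move: (normc (leapfrog lam m.+1)) => b u v a u0 v0 b0 a0 h1 h2.
have : u ^+ 2 <= (9 / 8 * a + 8^-1 * b) ^+ 2 by rewrite lerXn2r ?nnegrE //; lra.
have : v ^+ 2 <= ((b + a) / 8) ^+ 2 by rewrite lerXn2r ?nnegrE //; lra.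
by nra.
Qed.

Lemma invmx_eigvecmx : invmx (eigvecmx x) =
  \matrix_(j, k) ((pairing m (l j) (l j))^-1 * left_eigenvector (l j) k).
Proof.
set W := (RHS).
have WV : W *m eigvecmx x = 1%:M.
  apply/matrixP => j j'; rewrite !mxE.
  under eq_bigr do rewrite mxE eigvecmxE -mulrA.
  rewrite -mulr_sumr sum_left_eigenvector_leapfrog; case: eqVneq => [->|jj].
    by rewrite mulVf ?pairing_neq0.
  by rewrite (pairing_orthogonal F4 (lc j) (lc j') (l_inj jj)) mulr0.
have [_ Vu] := mulmx1_unit WV.
by rewrite -[RHS](mulmxK Vu) WV mul1mx.
Qed.

Lemma frobenius2_eigvecmx :
  frobenius2 (eigvecmx x) = \sum_j colnorm2 m (l j).
Proof.
rewrite /frobenius2 exchange_big; apply: eq_bigr => j _.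
by apply: eq_bigr => k _; rewrite eigvecmxE.
Qed.

Lemma frobenius2_invmx_eigvecmx :
  frobenius2 (invmx (eigvecmx x))
    <= (40 / m.+2%:R) ^+ 2 * frobenius2 (eigvecmx x).
Proof.
rewrite invmx_eigvecmx frobenius2_eigvecmx mulr_sumr.
apply: ler_sum => j _.
under eq_bigr do rewrite mxE normcM exprMn.
rewrite -mulr_sumr.
rewrite [leRHS](_ : _ = (20 / m.+2%:R) ^+ 2 * (4 * colnorm2 m (l j))).
  apply: ler_pM; rewrite ?sqr_ge0 ?sumr_ge0 ?left_eigenvector_norm2 //.
    by move=> k _; rewrite sqr_ge0.
  by rewrite lerXn2r ?nnegrE ?normc_ge0 ?divr_ge0 // normc_pairing_inv.
by rewrite !exprMn; ring.
Qed.

Lemma frobenius2_eigvecmx_le :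
  frobenius2 (eigvecmx x) <= (256 + 86 * 375 * 4) * m.+2%:R ^+ 4.
Proof.
have tr := sum_Re_inv_eigenvalue x_inj x_root.
have re0 j : 0 <= Re (l j)^-1.
  by rewrite Re_inv divr_ge0 ?sqr_ge0 // ltW // (closes_Re_gt0 (lc j)).
rewrite frobenius2_eigvecmx.
apply: le_trans (_ : \sum_j m.+2%:R ^+ 3 * (256 + 86 * 375 * Re (l j)^-1) <= _).
  apply: ler_sum => j _; apply: colnorm2_le => //.
  apply: le_trans tr; rewrite (bigD1 j) //= lerDl sumr_ge0 // => k _.
  exact: re0.
rewrite -mulr_sumr big_split /= sumr_const card_ord -mulr_sumr.
rewrite (exprSr _ 3) [leRHS]mulrCA ler_wpM2l ?exprn_ge0 //.
rewrite -[X in X + _]mulr_natr; lra.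
Qed.

(** The Frobenius norm of the inverse is at most [40 / n] times that of the
    matrix, so the product is at most [40 / n] times the squared norm,
    which is [O(n^4)]. *)
Lemma cond2_eigvecmx_le :
  cond2 (eigvecmx x) <= 40 * (256 + 86 * 375 * 4) * m.+2%:R ^+ 3.
Proof.
apply: le_trans (cond2_le_frobenius _) _.
have K0 := frobenius2_ge0 (eigvecmx x).
have N0 : m.+2%:R != 0 :> R by rewrite pnatr_eq0.
have h := frobenius2_eigvecmx_le.
apply: le_trans (_ : 40 / m.+2%:R * frobenius2 (eigvecmx x) <= _).
  rewrite -[leRHS]ger0_norm ?mulr_ge0 ?invr_ge0 // -sqrtr_sqr ler_wsqrtr //.
  rewrite exprMn [leRHS]mulrC expr2 -mulrA ler_wpM2l // mulrC.
  exact: frobenius2_invmx_eigvecmx.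
apply: le_trans (_ : 40 / m.+2%:R * ((256 + 86 * 375 * 4) * m.+2%:R ^+ 4) <= _).
  by rewrite ler_wpM2l // divr_ge0.
move: (m.+2%:R) (256 + _) N0 => N c N0.
by rewrite [leLHS](_ : _ = 40 * c * N ^+ 3) //; field.
Qed.

End LeftEigenvectors.

(** * The condition number *)

Theorem theorem3p3 (R : realType) :
  exists2 C : R, 0 < C &
    forall (n : nat) (x : 'I_n -> R[i]), (3 <= n)%N -> distinct_roots x ->
      cond2 (eigvecmx x) <= C * n%:R ^+ 3.
Proof.
exists (40 * (256 + 86 * 375 * 4)).
  by rewrite mulr_gt0 ?addr_gt0 ?mulr_gt0.
case=> [|[|m]] // x _ [x_inj x_root]; apply: cond2_eigvecmx_le => // j.
by apply/x_root; exists j.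
Qed.
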